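(* Let $X=(X_1,\ldots,X_n)$ be a random variable taking values in the set $S=S_1\times\cdots\times S_n$, where each $S_j$ is a finite set and each coordinate $X_j$ is a random variable taking values in $S_j$. For a subset $I$ of $\{1,\ldots,n\}$, let $X(I)$ denote the random variable $(X_j)_{j\in I}$. Suppose that $\mathcal{G}$ is a family of subsets of $\{1,\ldots,n\}$ and that each $j\in\{1,\ldots,n\}$ belongs to at least $k$ members of $\mathcal{G}$. Then for all $\alpha\geq1$, $$k\,H_\alpha(X)\leq\sum_{G\in\mathcal{G}}H_\alpha\bigl(X(G)\bigr).$$
   Context: For a discrete random variable $X$ with values in a finite set $\Omega_X$ and probabilities $p(x)$, the Tsallis--Havrda--Charv\'at entropy of degree $\alpha>0$, $\alpha\neq1$, is $H_\alpha(X)=\frac{1}{1-\alpha}\left(\sum_{x\in\Omega_X}p(x)^\alpha-1\right)$, and $H_1(X)=-\sum_{x\in\Omega_X}p(x)\ln p(x)$ is the Shannon entropy (with $0\ln0=0$). For a tuple of random variables, $H_\alpha$ is computed from the joint distribution. *)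

(* Defs.v *)
From mathcomp Require Import all_boot all_order all_algebra.
From mathcomp Require Import all_classical all_reals all_analysis.

Set Implicit Arguments.
Unset Strict Implicit.
Unset Printing Implicit Defensive.

Import Order.TTheory GRing.Theory Num.Theory.

Local Open Scope classical_set_scope.
Local Open Scope ring_scope.

(* Measurability with respect to the power-set sigma-algebra on the finite
   codomain.  The library's {RV P >-> A} is not used because it would require
   a measurableType (hence pointed) structure on A. *)
Definition discrete_rv (d : measure_display) (T : measurableType d)
    (A : finType) (Y : T -> A) : Prop :=
  forall a : A, measurable (Y @^-1` [set a]).

Definition pmass (d : measure_display) (T : measurableType d) (R : realType)
    (P : probability T R) (A : finType) (Y : T -> A) (a : A) : R :=
  fine (P (Y @^-1` [set a])).

(* The convention 0 ln 0 = 0 holds since ln 0 = 0 in the library, and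
   0 `^ alpha = 0 for alpha != 0. *)
Definition tsallis (d : measure_display) (T : measurableType d) (R : realType)
    (P : probability T R) (alpha : R) (A : finType) (Y : T -> A) : R :=
  if alpha == 1 then - \sum_(a : A) pmass P Y a * ln (pmass P Y a)
  else (1 - alpha)^-1 * (\sum_(a : A) pmass P Y a `^ alpha - 1).

(* X(I) = (X_j)_(j in I), with values in the product of the S_j over j in I
   (a one-point set when I is empty). *)
Definition subtuple (n : nat) (S : 'I_n -> finType) (T : Type)
    (X : T -> {dffun forall j : 'I_n, S j}) (I : {set 'I_n}) (t : T) :
    {dffun forall j : {j : 'I_n | j \in I}, S (val j)} :=
  [ffun j : {j : 'I_n | j \in I} => X t (val j)].

(* Main.v *)
Require Import Defs.
From mathcomp Require Import all_boot all_order all_algebra.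
From mathcomp Require Import all_classical all_reals all_analysis.
From mathcomp Require Import ring lra.

(** Let h(I) be the entropy of X(I), a function on the subsets of the index
    set.  The inequality is Shearer's lemma, which holds for every set function
    that vanishes on the empty set, is monotone and is submodular
    ([shearer_submodular]).  So everything reduces to strong subadditivity of
    the Tsallis entropy for degrees alpha >= 1.

    To avoid a different codomain for each I, all the entropies are written as
    expectations over one law p on the full product: h(I) is the mean of
    [surprisal alpha (q_I x)], where q_I(x), the [marginal], is the mass of the
    points that agree with x on I ([tsallis_subtuple]).  The surprisal is the
    deformed logarithm of 1/t, which is -ln t for alpha = 1; it decreases in t,
    and q_I decreases in I, whence monotonicity.

    Strong subadditivity has a pointwise part and an averaged part.  With
    U = A union B and I = A inter B, [surprisal_exchange] bounds
    psi(q_A) + psi(q_B) - psi(q_U) - psi(q_I) from below, psi being the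
    surprisal, by w (1 - q_A q_B / (q_U q_I)) with weight w = q_B^(alpha - 1).
    The mean of this bound is nonnegative by [expect_cond_indep]: the ratio
    q_A q_B / (q_U q_I) is the density, with respect to the law of X(U), of the
    coupling in which X(A) and X(B) are conditionally independent given X(I);
    this coupling preserves the law of X(B), and w is a function of X(B).  The
    pointwise bound is where alpha >= 1 enters, and it treats the Shannon case
    and the case alpha > 1 in the same way. *)

Set Implicit Arguments.
Unset Strict Implicit.
Unset Printing Implicit Defensive.

Import Order.TTheory GRing.Theory Num.Theory.

Local Open Scope ring_scope.

(** * Shearer's lemma for submodular set functions *)

(** Reveal the indices in increasing order.  By submodularity, the gain of j is
    at least as large when it is added to the earlier indices in G i only as
    when it is added to all earlier indices; hence h (G i) dominates the sum of
    the full gains of its members.  Summing over i counts each full gain at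
    least k times, the gains are nonnegative, and they telescope to the value
    of h on the full set. *)
Lemma shearer_submodular {R : realDomainType} (n : nat) (h : {set 'I_n} -> R)
    (h0 : h finset.set0 = 0)
    (hmono : forall A B : {set 'I_n}, A \subset B -> h A <= h B)
    (hsub : forall A B : {set 'I_n},
       h (A :|: B)%SET + h (A :&: B)%SET <= h A + h B)
    (J : finType) (G : J -> {set 'I_n}) (k : nat)
    (hG : forall j : 'I_n, (k <= #|[set i : J | j \in G i]%SET|)%N) :
  k%:R * h [set: 'I_n]%SET <= \sum_(i : J) h (G i).
Proof.
pose below m : {set 'I_n} := [set i : 'I_n | (i < m)%N]%SET.
pose gain (j : 'I_n) := h (below j.+1) - h (below j).
have belowS (j : 'I_n) : below j.+1 = (below j :|: [set j])%SET.
  by apply/setP => i; rewrite !inE ltnS leq_eqVlt orbC -val_eqE.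
have gain_ge0 j : 0 <= gain j.
  by rewrite subr_ge0 hmono// belowS; apply: finset.subsetUl.
have chain (A : {set 'I_n}) :
    h A = \sum_(j < n) (h (A :&: below j.+1)%SET - h (A :&: below j)%SET).
  rewrite -(big_mkord xpredT
    (fun m => h (A :&: below m.+1)%SET - h (A :&: below m)%SET)).
  rewrite telescope_sumr//.
  have -> : below 0%N = finset.set0 by apply/setP => i; rewrite !inE.
  have -> : below n = [set: 'I_n]%SET by apply/setP => i; rewrite !inE ltn_ord.
  by rewrite finset.setIT finset.setI0 h0 subr0.
have hfull : h [set: 'I_n]%SET = \sum_(j < n) gain j.
  by rewrite chain; apply: eq_bigr => j _; rewrite !finset.setTI.
have le_part (A : {set 'I_n}) : \sum_(j < n | j \in A) gain j <= h A.
  rewrite [leRHS]chain big_mkcond/= ler_sum// => j _.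
  case: ifPn => jA; last first.
    by rewrite subr_ge0 hmono// belowS finset.setIUr finset.subsetUl.
  (* Submodularity for these two sets compares the two gains of j: their union
     is below j.+1 and their intersection is A :&: below j. *)
  have := hsub (A :&: below j.+1)%SET (below j).
  have -> : (A :&: below j.+1 :|: below j = below j.+1)%SET.
    apply/setP => i; rewrite belowS !inE -val_eqE/=.
    by have [ij|ij|/val_inj->] := ltngtP i j; rewrite ?andbF ?andbT ?orbT ?jA.
  have -> : (A :&: below j.+1 :&: below j = A :&: below j)%SET.
    rewrite -finset.setIA; congr (_ :&: _)%SET; apply/finset.setIidPr.
    by rewrite belowS finset.subsetUl.
  by rewrite /gain; lra.
apply: (@le_trans _ _ (\sum_(i : J) \sum_(j < n | j \in G i) gain j)); last first.
  by apply: ler_sum => i _; exact: le_part.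
rewrite (exchange_big_dep xpredT)//= hfull mulr_sumr ler_sum// => j _.
rewrite sumr_const -[leRHS]mulr_natl ler_wpM2r// ler_nat.
by apply: leq_trans (hG j) _; rewrite cardsE.
Qed.

(** * The deformed logarithm of the inverse *)

Section Surprisal.
Context {R : realType}.

Definition surprisal (alpha t : R) : R :=
  if alpha == 1 then - ln t else (1 - t `^ (alpha - 1)) / (alpha - 1).

Lemma surprisal1 (alpha : R) : surprisal alpha 1 = 0.
Proof. by rewrite /surprisal; case: ifP; rewrite ?ln1 ?oppr0// powR1 subrr mul0r. Qed.

Lemma le_surprisal (alpha s t : R) : 1 <= alpha -> 0 < s -> s <= t ->
  surprisal alpha t <= surprisal alpha s.
Proof.
move=> a1 s0 st; have t0 : 0 < t by exact: lt_le_trans st.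
rewrite /surprisal; case: eqVneq => [_|a_neq1].
  by rewrite lerN2 ler_ln.
have b0 : 0 < alpha - 1 by rewrite subr_gt0 lt_def a_neq1.
rewrite ler_pM2r ?invr_gt0// lerB// ge0_ler_powR// ?nnegrE ltW//.
Qed.

Lemma ln_ge_1BV (t : R) : 0 < t -> 1 - t^-1 <= ln t.
Proof.
move=> t0; have V0 : 0 < t^-1 by rewrite invr_gt0.
have : -1 < t^-1 - 1 by lra.
by move=> /le_ln1Dx; rewrite [1 + _]addrC subrK lnV ?posrE//; lra.
Qed.

(** Put b = alpha - 1 and r = u c / (s t).  The hypothesis u <= s <= c makes
    (c^b - s^b)(s^b - u^b) nonnegative, so that u^b + c^b - s^b >= (u c / s)^b,
    which is t^b r^b.  For b > 0 the bound follows from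
    r^b >= 1 + b ln r >= 1 + b (1 - 1/r).  For b = 0 the right-hand side is
    exactly ln r, and ln r >= 1 - 1/r is the bound itself. *)
Lemma surprisal_exchange (alpha u s t c : R) : 1 <= alpha ->
    0 < u -> u <= s -> s <= c -> 0 < t ->
  t `^ (alpha - 1) * (1 - s * t / (u * c)) <=
  surprisal alpha s + surprisal alpha t - (surprisal alpha u + surprisal alpha c).
Proof.
move=> a1 u0 us sc t0.
have s0 : 0 < s by exact: lt_le_trans us.
have c0 : 0 < c by exact: lt_le_trans sc.
pose r := u * c / (s * t).
have r0 : 0 < r by rewrite divr_gt0// mulr_gt0.
have -> : s * t / (u * c) = r^-1 by rewrite /r invf_div.
have lnr : 1 - r^-1 <= ln r by exact: ln_ge_1BV.
rewrite /surprisal; case: eqVneq => [->|a_neq1].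
  rewrite subrr powRr0 mul1r (le_trans lnr)//.
  rewrite /r ln_div ?posrE ?mulr_gt0// !lnM ?posrE//; lra.
have b0 : 0 < alpha - 1 by rewrite subr_gt0 lt_def a_neq1.
set b := alpha - 1 in b0 *.
have expr : 1 + b * ln r <= r `^ b.
  by rewrite /powR gt_eqF// expR_ge1Dx.
have tr : t `^ b * r `^ b <= u `^ b + c `^ b - s `^ b.
  have sb0 : 0 < s `^ b by exact: powR_gt0.
  rewrite -(ler_pM2l sb0) mulrA -(powRM _ (ltW s0) (ltW t0)).
  rewrite -(powRM _ (mulr_ge0 (ltW s0) (ltW t0)) (ltW r0)).
  have -> : s * t * r = u * c by rewrite /r; field; rewrite !gt_eqF.
  rewrite (powRM _ (ltW u0) (ltW c0)).
  have usb : u `^ b <= s `^ b by rewrite ge0_ler_powR ?nnegrE// ltW.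
  have scb : s `^ b <= c `^ b by rewrite ge0_ler_powR ?nnegrE// ltW.
  have : 0 <= (c `^ b - s `^ b) * (s `^ b - u `^ b).
    by rewrite mulr_ge0// subr_ge0.
  lra.
have tb0 : 0 < t `^ b by exact: powR_gt0.
rewrite [leRHS](_ : _ = (u `^ b + c `^ b - s `^ b - t `^ b) / b); last by ring.
rewrite ler_pdivlMr//.
have : t `^ b * (1 + b * (1 - r^-1)) <= t `^ b * r `^ b.
  by rewrite ler_pM2l// (le_trans _ expr)// lerD2l ler_pM2l.
by lra.
Qed.

End Surprisal.

(** * Entropy as a set function for a law on a finite product *)

Section FiniteMarginals.
Context {R : realType} {n : nat} {S : 'I_n -> finType}.
Local Notation states := {dffun forall j : 'I_n, S j}.
Variable p : states -> R.
Hypothesis p_ge0 : forall x, 0 <= p x.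
Hypothesis p_sum : \sum_x p x = 1.
Implicit Types (alpha : R) (A B : {set 'I_n}) (x y z : states).

Definition agree A x y : bool := [forall (j | j \in A), x j == y j].

(** The mass at x restricted to A of the A-marginal of p, pulled back to the
    full product so that all marginals live on the same space. *)
Definition marginal A x : R := \sum_(y | agree A x y) p y.

Definition set_entropy (alpha : R) A : R :=
  \sum_x p x * surprisal alpha (marginal A x).

Lemma agreeP A x y : reflect {in A, forall j, x j = y j} (agree A x y).
Proof. by apply: (iffP forall_inP) => H j /H /eqP. Qed.

Lemma agree_refl A x : agree A x x.
Proof. exact/agreeP. Qed.

Lemma agree_sym A x y : agree A x y = agree A y x.
Proof. by apply/agreeP/agreeP => H j /H. Qed.

Lemma agree_subset A B x y : A \subset B -> agree B x y -> agree A x y.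
Proof. by move=> /fintype.subsetP AB /agreeP H; apply/agreeP => j /AB /H. Qed.

Lemma agree_trans A x y z : agree A x y -> agree A y z -> agree A x z.
Proof. by move=> /agreeP H /agreeP H'; apply/agreeP => j jA; rewrite H// H'. Qed.

Lemma agree_setU A B x y : agree (A :|: B)%SET x y = agree A x y && agree B x y.
Proof.
apply/agreeP/andP => [H|[/agreeP HA /agreeP HB] j].
  by split; apply/agreeP => j jA; rewrite H// inE jA ?orbT.
by rewrite inE => /orP[/HA|/HB].
Qed.

Lemma agree_set0 x y : agree finset.set0 x y.
Proof. by apply/agreeP => j; rewrite inE. Qed.

Lemma agree_setT x y : agree [set: 'I_n]%SET x y = (y == x).
Proof.
apply/agreeP/eqP => [H|->//].
by apply/ffunP => j; rewrite H ?inE.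
Qed.

Lemma marginal_agree A x y : agree A x y -> marginal A x = marginal A y.
Proof.
move=> xy; apply: eq_bigl => z; apply/idP/idP; last exact: agree_trans.
by apply: agree_trans; rewrite agree_sym.
Qed.

Lemma marginal_subset A B x : A \subset B -> marginal B x <= marginal A x.
Proof.
move=> AB; rewrite /marginal big_mkcond [leRHS]big_mkcond/= ler_sum// => y _.
have [/(agree_subset AB) ->//|_] := ifP.
by case: ifP.
Qed.

Lemma marginal_ge A x : p x <= marginal A x.
Proof.
by rewrite /marginal (bigD1 x) ?agree_refl//= lerDl sumr_ge0.
Qed.

Lemma marginal_ge0 A x : 0 <= marginal A x.
Proof. by rewrite sumr_ge0. Qed.

Lemma marginal_gt0 A x : 0 < p x -> 0 < marginal A x.
Proof. by move=> /lt_le_trans; apply; exact: marginal_ge. Qed.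

Lemma marginal_set0 x : marginal finset.set0 x = 1.
Proof. by rewrite -p_sum; apply: eq_bigl => y; rewrite agree_set0. Qed.

Lemma marginal_setT x : marginal [set: 'I_n]%SET x = p x.
Proof. by rewrite /marginal (big_pred1 x)// => y; rewrite agree_setT. Qed.

Lemma le_expect (f g : states -> R) :
    (forall x, 0 < p x -> f x <= g x) ->
  \sum_x p x * f x <= \sum_x p x * g x.
Proof.
move=> fg; apply: ler_sum => x _.
have := p_ge0 x; rewrite le_eqVlt => /predU1P[<-|px]; first by rewrite !mul0r.
by rewrite ler_pM2l// fg.
Qed.

(** The marginal is constant on the cell of x, where p sums to it; the sum is
    therefore 1, or 0 if the cell has mass 0, since division by 0 gives 0. *)
Lemma agree_cell_sum A x : \sum_(y | agree A x y) p y / marginal A y <= 1.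
Proof.
under eq_bigr => y xy do rewrite -(marginal_agree xy).
rewrite -mulr_suml -/(marginal A x).
have := marginal_ge0 A x; rewrite le_eqVlt => /predU1P[<-|m0].
  by rewrite mul0r ler01.
by rewrite divff// gt_eqF.
Qed.

(** Averaging w over the conditionally independent coupling of the A- and
    B-coordinates given the common ones cannot exceed its average under p,
    since the coupling keeps the B-marginal; it is an inequality, because points
    where p vanishes but the coupling does not are absent on the left.
    Expanding the marginals of A and B as sums over y and z, the points x that
    agree with y on A and with z on B form one cell for A :|: B or none, and
    there is one only if y and z agree on A :&: B. *)
Lemma expect_cond_indep A B (w : states -> R) :
    (forall x, 0 <= w x) -> (forall x y, agree B x y -> w x = w y) ->
  \sum_x p x * (w x * (marginal A x * marginal B x /
      (marginal (A :|: B)%SET x * marginal (A :&: B)%SET x)))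
  <= \sum_x p x * w x.
Proof.
move=> w_ge0 wB; set U := (A :|: B)%SET; set I := (A :&: B)%SET.
have IB : I \subset B by exact: finset.subsetIr.
have IA : I \subset A by exact: finset.subsetIl.
(* p z / marginal I z is the conditional mass of z given its coordinates in I,
   so for y and z that agree on I, F z * p y is w z times the mass of the
   pair when y and z are drawn independently given these coordinates. *)
pose F (z : states) := p z * w z / marginal I z.
have F_ge0 z : 0 <= F z by rewrite divr_ge0 ?mulr_ge0 ?marginal_ge0.
apply: (@le_trans _ _ (\sum_z F z * marginal I z)); last first.
  apply: ler_sum => z _; rewrite /F.
  have := marginal_ge0 I z; rewrite le_eqVlt => /predU1P[<-|m0].
    by rewrite mulr0 mulr_ge0.
  by rewrite divfK// gt_eqF.
have -> : \sum_x p x * (w x * (marginal A x * marginal B x /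
      (marginal U x * marginal I x))) =
    \sum_z \sum_y \sum_(x | agree A x y && agree B x z)
      F z * p y * (p x / marginal U x).
  transitivity (\sum_x \sum_(z | agree B x z) \sum_(y | agree A x y)
      F z * p y * (p x / marginal U x)).
    apply: eq_bigr => x _.
    rewrite (_ : p x * _ = p x / marginal U x * (marginal A x * (w x *
      marginal B x / marginal I x))); last by rewrite invfM; ring.
    rewrite [marginal B x]/marginal [w x * _]mulr_sumr mulr_suml !mulr_sumr.
    apply: eq_bigr => z xz; rewrite [marginal A x]/marginal mulr_suml mulr_sumr.
    apply: eq_bigr => y _.
    rewrite /F (wB _ _ xz) (marginal_agree (agree_subset IB xz)).
    ring.
  rewrite (exchange_big_dep xpredT)//=; apply: eq_bigr => z _.
  rewrite (exchange_big_dep xpredT)//=; apply: eq_bigr => y _.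
  by apply: eq_bigl => x; rewrite andbC.
apply: ler_sum => z _; rewrite [marginal I z]/marginal mulr_sumr [leRHS]big_mkcond/=.
apply: ler_sum => y _; rewrite -mulr_sumr.
case: (pickP (fun x => agree A x y && agree B x z)) => [x0|none]; last first.
  rewrite big_pred0// mulr0; case: ifP => // _; exact: mulr_ge0.
move=> /andP[x0y x0z].
have zy : agree I z y.
  apply: (@agree_trans _ _ x0); last exact: agree_subset x0y.
  by rewrite agree_sym; exact: agree_subset x0z.
rewrite zy ler_piMr// ?(mulr_ge0 (F_ge0 z))//.
rewrite (eq_bigl (agree U x0)); first exact: agree_cell_sum.
move=> x; rewrite agree_setU; congr (_ && _).
  apply/idP/idP; first by move=> xy; apply: agree_trans x0y _; rewrite agree_sym.
  by rewrite agree_sym => /agree_trans; apply.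
apply/idP/idP; first by move=> xy; apply: agree_trans x0z _; rewrite agree_sym.
by rewrite agree_sym => /agree_trans; apply.
Qed.

Lemma set_entropy0 alpha : set_entropy alpha finset.set0 = 0.
Proof.
by apply: big1 => x _; rewrite marginal_set0 surprisal1 mulr0.
Qed.

Lemma set_entropy_mono alpha A B : 1 <= alpha -> A \subset B ->
  set_entropy alpha A <= set_entropy alpha B.
Proof.
move=> a1 AB; apply: le_expect => x px.
by rewrite le_surprisal ?marginal_gt0// marginal_subset.
Qed.

(** Strong subadditivity: the average of the pointwise bound
    [surprisal_exchange] is nonnegative by [expect_cond_indep], applied to a
    weight that depends only on the coordinates in B. *)
Lemma set_entropy_submod alpha A B : 1 <= alpha ->
  set_entropy alpha (A :|: B)%SET + set_entropy alpha (A :&: B)%SET <=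
  set_entropy alpha A + set_entropy alpha B.
Proof.
move=> a1; rewrite -subr_ge0 /set_entropy -!big_split/= -sumrB.
pose w x := marginal B x `^ (alpha - 1).
have w_ge0 x : 0 <= w x by exact: powR_ge0.
have wB x y : agree B x y -> w x = w y by move=> xy; rewrite /w (marginal_agree xy).
have := @expect_cond_indep A B w w_ge0 wB.
rewrite -subr_ge0 -sumrB => /le_trans; apply.
under eq_bigr do rewrite -mulrBr.
under [leRHS]eq_bigr do rewrite -!mulrDr -mulrBr.
apply: le_expect => x px; rewrite -[X in X - _]mulr1 -mulrBr.
apply: surprisal_exchange; rewrite ?marginal_gt0//.
  by apply: marginal_subset; exact: finset.subsetUl.
by apply: marginal_subset; exact: finset.subsetIl.
Qed.

End FiniteMarginals.

(** * From random variables to laws on a finite set *)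

Section Laws.
Context {d : measure_display} {T : measurableType d} {R : realType}.
Variable P : probability T R.

Lemma pmass_ge0 (A : finType) (Y : T -> A) a : 0 <= pmass P Y a.
Proof. exact: fine_ge0. Qed.

Lemma pmass_comp {A B : finType} {Y : T -> A} (f : A -> B) (b : B) :
  discrete_rv Y -> pmass P (f \o Y) b = \sum_(a | f a == b) pmass P Y a.
Proof.
move=> mY; rewrite /pmass.
have -> : ((f \o Y) @^-1` [set b] =
    \bigcup_(a in [set` enum [pred a | f a == b]]) (Y @^-1` [set a]))%classic.
  apply/seteqP; split => [t /= <-|t [a /=]]; last first.
    by rewrite mem_enum inE => /eqP <- ->.
  by exists (Y t) => //=; rewrite mem_enum inE.
rewrite measure_fin_bigcup//; last first.
  by move=> a a' _ _ [t [/= -> ->]].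
rewrite -fsbig_seq ?enum_uniq// -sum_fine; last first.
  by move=> a _; exact: fin_num_measure.
by rewrite big_enum.
Qed.

Lemma sum_pmass {A : finType} {Y : T -> A} :
  discrete_rv Y -> \sum_a pmass P Y a = 1.
Proof.
move=> mY; transitivity (pmass P ((fun=> tt) \o Y) tt).
  by rewrite pmass_comp//; apply: eq_bigl => a; rewrite eqxx.
rewrite /pmass (_ : (_ @^-1` _)%classic = setT) ?probability_setT//.
by apply/seteqP; split.
Qed.

(** The hypothesis alpha > 0 covers the values of mass 0: there both the power
    alpha of the mass and the product on the right vanish. *)
Lemma tsallis_surprisal (alpha : R) {A : finType} {Y : T -> A} : 0 < alpha ->
    \sum_a pmass P Y a = 1 ->
  tsallis P alpha Y = \sum_a pmass P Y a * surprisal alpha (pmass P Y a).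
Proof.
move=> a0 Y1; rewrite /tsallis /surprisal; case: eqVneq => [_|a_neq1].
  by rewrite -sumrN; apply: eq_bigr => a _; rewrite mulrN.
have b0 : alpha - 1 != 0 by rewrite subr_eq0.
under [RHS]eq_bigr => a _ do
  rewrite mulrA mulrBr mulr1 mulr_powRB1 ?pmass_ge0//.
rewrite -mulr_suml sumrB Y1 -[1 - alpha]opprB invrN mulrC.
by rewrite mulrN -mulNr opprB.
Qed.

Lemma tsallis_comp (alpha : R) {A B : finType} {Y : T -> A} (f : A -> B) :
    0 < alpha -> discrete_rv Y ->
  tsallis P alpha (f \o Y) =
  \sum_a pmass P Y a * surprisal alpha (pmass P (f \o Y) (f a)).
Proof.
move=> a0 mY; rewrite tsallis_surprisal//; last first.
  under eq_bigr do rewrite pmass_comp//.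
  by rewrite -(sum_pmass mY) [RHS](partition_big f xpredT).
rewrite [RHS](partition_big f xpredT)//=; apply: eq_bigr => b _.
rewrite {1}pmass_comp// mulr_suml; apply: eq_bigr => a /eqP <-//.
Qed.

Lemma tsallis_subtuple (alpha : R) {n : nat} {S : 'I_n -> finType}
    {X : T -> {dffun forall j : 'I_n, S j}} (I : {set 'I_n}) :
    0 < alpha -> discrete_rv X ->
  tsallis P alpha (subtuple X I) = set_entropy (pmass P X) alpha I.
Proof.
move=> a0 mX.
pose f (x : {dffun forall j : 'I_n, S j}) :
  {dffun forall j : {j : 'I_n | j \in I}, S (val j)} :=
  [ffun j : {j : 'I_n | j \in I} => x (val j)].
rewrite (tsallis_comp f)//; apply: eq_bigr => x _; congr (_ * surprisal _ _).
rewrite pmass_comp//; apply: eq_bigl => y; apply/eqP/agreeP => [H j jI|H].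
  by have /ffunP/(_ (exist _ j jI)) := H; rewrite !ffunE.
by apply/ffunP => -[j jI]; rewrite !ffunE/= H.
Qed.

End Laws.

(** * The Shearer inequality for Tsallis entropies *)

Theorem proposition7 (R : realType) (d : measure_display)
    (T : measurableType d) (P : probability T R)
    (n : nat) (S : 'I_n -> finType)
    (X : T -> {dffun forall j : 'I_n, S j}) (hX : discrete_rv X)
    (J : finType) (G : J -> {set 'I_n}) (k : nat)
    (hG : forall j : 'I_n, (k <= #|[set i : J | j \in G i]%SET|)%N)
    (alpha : R) (halpha : 1 <= alpha) :
  k%:R * tsallis P alpha X <= \sum_(i : J) tsallis P alpha (subtuple X (G i)).
Proof.
have a0 : 0 < alpha by exact: lt_le_trans halpha.
have p_ge0 x := pmass_ge0 P X x.
have p_sum := sum_pmass P hX.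
have -> : tsallis P alpha X = set_entropy (pmass P X) alpha [set: 'I_n]%SET.
  rewrite tsallis_surprisal//; apply: eq_bigr => x _.
  by rewrite marginal_setT.
under eq_bigr do rewrite tsallis_subtuple//.
apply: shearer_submodular => //.
- exact: set_entropy0.
- by move=> A B; exact: set_entropy_mono.
- by move=> A B; exact: set_entropy_submod.
Qed.
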